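(* Suppose $(X_t)_{t>0}$ is a quadratic harness with parameters $q,\eta,\theta,\sigma,\tau$ such that $(1-\sigma\tau)^2+(\eta+\theta\sigma)(\theta+\eta\tau)>0$, $0\le\sigma\tau<1$, and $q=1-2\sqrt{\sigma\tau}$. Put $\rho=\sqrt{\sigma\tau}$. If for each $t>0$ the random variable $X_t$ has all moments and infinite support, then $(X_t)$ has orthogonal martingale polynomials given by $p_0(x;t)=1$ and the three step recurrences $$x\,p_0(x;t)=p_1(x;t),$$ $$x\,p_1(x;t)=(1+\sigma t)p_2(x;t)+\frac{(\eta+\theta\sigma)t+(\eta\tau+\theta)}{1-\sigma\tau}p_1(x;t)+t\,p_0(x;t),$$ and for $n\ge2$ $$x\,p_n(x;t)=\big(1+(n-1)\rho+n\sigma t\big)p_{n+1}(x;t)+(\gamma_nt+\delta_n)p_n(x;t)+\omega_n^\circ\big((1+(n-2)\rho)t+\tau(n-1)\big)p_{n-1}(x;t),$$ where, for $n\ge1$, $$\gamma_n=\frac{n(1+(n-2)\rho)}{(1-\rho)^2(1+(2n-1)\rho)(1+(2n-3)\rho)}\Big(\eta+(2n-1)\theta\sigma+(2n-3)\eta\rho+2(n-1)^2\eta\rho^2+(2(n-1)^2-1)\theta\sigma\rho\Big),$$ $$\delta_n=\frac{n(1+(n-2)\rho)}{(1-\rho)^2(1+(2n-1)\rho)(1+(2n-3)\rho)}\Big(\theta+(2n-1)\eta\tau+(2n-3)\theta\rho+2(n-1)^2\theta\rho^2+(2(n-1)^2-1)\eta\tau\rho\Big),$$ and, for $n\ge2$,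 $$\omega_n^\circ=\frac{n(1+(n-3)\rho)}{(1-\rho)^2(1+(2n-2)\rho)(1+(2n-4)\rho)}+\frac{n(n-1)(1+(n-2)\rho)(1+(n-3)\rho)}{(1-\rho)^4(1+(2n-2)\rho)(1+(2n-3)\rho)^2(1+(2n-4)\rho)}\times\big((1+(n-2)\rho)\theta+(n-1)\eta\tau\big)\big((1+(n-2)\rho)\eta+(n-1)\theta\sigma\big).$$
   Context: Equalities between conditional expectations hold almost surely. $(X_t)_{t>0}$ is a separable square-integrable real process; $\mathcal F_{s,u}=\sigma\{X_t:t\in(0,s]\cup[u,\infty)\}$, $\mathcal F_{\le s}=\sigma\{X_t:0<t\le s\}$; $\mathrm{Var}[X\mid\mathcal F]=\mathbb{E}[X^2\mid\mathcal F]-(\mathbb{E}[X\mid\mathcal F])^2$; $\Delta_{s,u}=\frac{X_u-X_s}{u-s}$, $\widetilde\Delta_{s,u}=\frac{uX_s-sX_u}{u-s}$. For real $q,\eta,\theta$ and $\sigma,\tau\ge0$, $(X_t)$ is a quadratic harness with parameters $q,\eta,\theta,\sigma,\tau$ if $\mathbb{E}(X_t)=0$, $\mathbb{E}(X_sX_t)=\min\{s,t\}$ for all $s,t>0$, and for all $0<s<t<u$ $$\mathbb{E}[X_t\mid\mathcal F_{s,u}]=\tfrac{u-t}{u-s}X_s+\tfrac{t-s}{u-s}X_u,$$ $$\mathrm{Var}[X_t\mid\mathcal F_{s,u}]=\tfrac{(u-t)(t-s)}{u(1+\sigma s)+\tau-qs}\Big(1+\eta\widetilde\Delta_{s,u}+\theta\Delta_{s,u}+\sigma\widetilde\Delta_{s,u}^2+\tau\Delta_{s,u}^2-(1-q)\Delta_{s,u}\widetilde\Delta_{s,u}\Big).$$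 Orthogonal martingale polynomials for $(X_t)$: polynomials $p_n(x;t)$ in $x$ of degree $n$ with $\mathbb{E}[p_n(X_t;t)\mid\mathcal F_{\le s}]=p_n(X_s;s)$ for all $0<s<t$, $n\ge0$, and $\mathbb{E}(p_n(X_t;t)p_m(X_t;t))=0$ for all $t>0$, $n\ne m$. ''Infinite support'' means the support of the law of $X_t$ is an infinite set. *)

(* Defs.v *)
From HB Require Import structures.
From mathcomp Require Import all_boot all_order all_algebra.
From mathcomp Require Import all_classical all_reals all_analysis.

Set Implicit Arguments.
Unset Strict Implicit.
Unset Printing Implicit Defensive.

Import Order.TTheory GRing.Theory Num.Theory.
Import numFieldNormedType.Exports.

Local Open Scope classical_set_scope.
Local Open Scope ring_scope.

(* [is_condE P F Y Z] reads "E[Y | F] = Z almost surely": [Z] is a version of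
   the conditional expectation of the integrable function [Y] given the
   sub-sigma-algebra [F]. *)
Definition is_condE d (T : measurableType d) (R : realType)
    (P : probability T R) (F : set (set T)) (Y Z : T -> R) : Prop :=
  [/\ P.-integrable setT (EFin \o Y),
      P.-integrable setT (EFin \o Z),
      g_sigma_algebra_preimage Z `<=` F &
      forall A : set T, F A ->
        (\int[P]_(w in A) (Z w)%:E = \int[P]_(w in A) (Y w)%:E)%E].

(* "Var[Y | F] = V almost surely". Versions are almost surely unique, so it
   does not matter which ones are picked. *)
Definition is_condVar d (T : measurableType d) (R : realType)
    (P : probability T R) (F : set (set T)) (Y V : T -> R) : Prop :=
  exists Y1 Y2 : T -> R,
    [/\ is_condE P F Y Y1,
        is_condE P F (fun w => Y w ^+ 2) Y2 &
        {ae P, forall w, Y2 w - Y1 w ^+ 2 = V w}].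

Section process.
Context {d : measure_display} {T : measurableType d} {R : realType}.
Variable P : probability T R.

(* The time set of all the processes below is (0, +oo): the variables [X t]
   with [t <= 0] are dummies, never referred to. *)
Variable X : R -> {RV P >-> R}.

Definition sigma_of (I : set R) : set (set T) :=
  <<s \bigcup_(t in I) g_sigma_algebra_preimage (X t) >>.

Definition past (s : R) : set (set T) := sigma_of [set t | 0 < t <= s].

Definition past_future (s u : R) : set (set T) :=
  sigma_of [set t | 0 < t <= s \/ u <= t].

(* Separability in the sense of Doob, for the class of closed sets. *)
Definition separable_process : Prop :=
  exists (D : set R) (N : set T),
    [/\ countable D, D `<=` [set t | 0 < t], P.-negligible N &
        forall (a b : R) (A : set R), 0 <= a -> a < b -> closed A ->
          [set w | forall t, D t -> a < t < b -> A (X t w)] `\`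
          [set w | forall t, a < t < b -> A (X t w)] `<=` N].

Definition square_integrable_process : Prop :=
  forall t : R, 0 < t -> (X t : T -> R) \in Lfun P 2%:E.

Definition Delta (s u : R) (w : T) : R := (X u w - X s w) / (u - s).

Definition tDelta (s u : R) (w : T) : R := (u * X s w - s * X u w) / (u - s).

Definition quadratic_harness (q eta theta sigma tau : R) : Prop :=
  [/\ forall t : R, 0 < t -> 'E_P[X t]%E = 0%E,
      forall s t : R, 0 < s -> 0 < t ->
        'E_P[fun w => (X s w * X t w)%R]%E = (Num.min s t)%:E,
      forall s t u : R, 0 < s -> s < t -> t < u ->
        is_condE P (past_future s u) (X t)
          (fun w => (u - t) / (u - s) * X s w + (t - s) / (u - s) * X u w) &
      forall s t u : R, 0 < s -> s < t -> t < u ->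
        is_condVar P (past_future s u) (X t)
          (fun w => (u - t) * (t - s) / (u * (1 + sigma * s) + tau - q * s) *
             (1 + eta * tDelta s u w + theta * Delta s u w
                + sigma * tDelta s u w ^+ 2 + tau * Delta s u w ^+ 2
                - (1 - q) * Delta s u w * tDelta s u w))].

(* [p n t] is the polynomial x |-> p_n(x; t), for t > 0. *)
Definition orthogonal_martingale_polynomials (p : nat -> R -> {poly R}) : Prop :=
  [/\ forall n t, 0 < t -> size (p n t) = n.+1,
      forall n (s t : R), 0 < s -> s < t ->
        is_condE P (past s) (fun w => (p n t).[X t w])
                            (fun w => (p n s).[X s w]) &
      forall n m t, 0 < t -> n != m ->
        'E_P[fun w => ((p n t).[X t w] * (p m t).[X t w])%R]%E = 0%E].

Definition has_all_moments (Y : {RV P >-> R}) : Prop :=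
  forall k : nat, P.-integrable setT (fun w => (Y w ^+ k)%:E).

Definition law_support (Y : {RV P >-> R}) : set R :=
  [set x | forall U : set R, open U -> U x -> (0 < distribution P Y U)%E].

End process.

Section recurrence_coefficients.
Context {R : realType}.
Variables rho eta theta sigma tau : R.

Definition gamma_coef (n : nat) : R :=
  let m := n%:R in
  m * (1 + (m - 2) * rho)
  / ((1 - rho) ^+ 2 * (1 + (2 * m - 1) * rho) * (1 + (2 * m - 3) * rho))
  * (eta + (2 * m - 1) * theta * sigma + (2 * m - 3) * eta * rho
     + 2 * (m - 1) ^+ 2 * eta * rho ^+ 2
     + (2 * (m - 1) ^+ 2 - 1) * theta * sigma * rho).

Definition delta_coef (n : nat) : R :=
  let m := n%:R in
  m * (1 + (m - 2) * rho)
  / ((1 - rho) ^+ 2 * (1 + (2 * m - 1) * rho) * (1 + (2 * m - 3) * rho))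
  * (theta + (2 * m - 1) * eta * tau + (2 * m - 3) * theta * rho
     + 2 * (m - 1) ^+ 2 * theta * rho ^+ 2
     + (2 * (m - 1) ^+ 2 - 1) * eta * tau * rho).

Definition omega_coef (n : nat) : R :=
  let m := n%:R in
  m * (1 + (m - 3) * rho)
  / ((1 - rho) ^+ 2 * (1 + (2 * m - 2) * rho) * (1 + (2 * m - 4) * rho))
  + m * (m - 1) * (1 + (m - 2) * rho) * (1 + (m - 3) * rho)
    / ((1 - rho) ^+ 4 * (1 + (2 * m - 2) * rho) * (1 + (2 * m - 3) * rho) ^+ 2
       * (1 + (2 * m - 4) * rho))
    * ((1 + (m - 2) * rho) * theta + (m - 1) * eta * tau)
    * ((1 + (m - 2) * rho) * eta + (m - 1) * theta * sigma).

End recurrence_coefficients.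

(* Main.v *)
Require Import Defs.
From HB Require Import structures.
From mathcomp Require Import all_boot all_order all_algebra.
From mathcomp Require Import all_classical all_reals all_analysis.
From mathcomp Require Import measurable_realfun.
From mathcomp Require Import ring lra.

(* Let [p_n] be the polynomials defined by the recurrence, so that multiplication
   by [x] acts on [(p_n(x;t))_n] as a Jacobi operator [t * opx + opy]. The explicit
   coefficients are exactly those for which
     [opy opx - q opx opy = 1 + eta opy + theta opx + sigma opy^2 + tau opx^2].
   The martingale property is proved by induction on the degree [n]. Fix [s] and an
   event [A] of the past of [s], and let [D(t)] be the difference of the integrals
   over [A] of [p_n(X_t;t)] and [p_n(X_s;s)]. For [s < t < u], integrating the
   harness equation against [p_{n-1}(X_u;u)] and the conditional variance equation
   against [p_{n-2}(X_u;u)] gives two linear relations between [D(t)] and [D(u)],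
   all other terms cancelling by the commutation relation; their determinant is
   nonzero, so [D = 0]. For [n = 1] there is only the first relation, which makes
   [D(t)] proportional to [t - s], whereas [D(u) = O(sqrt u)].
   The constant mean of [p_n(X_t;t)] is a multiple of [E(X_t p_{n-1}(X_1;1))], which
   vanishes as [t] tends to [0]; orthogonality then follows from the recurrence. *)

Set Implicit Arguments.
Unset Strict Implicit.
Unset Printing Implicit Defensive.

Import Order.TTheory GRing.Theory Num.Theory.
Import numFieldNormedType.Exports.

Local Open Scope classical_set_scope.
Local Open Scope ring_scope.

(** * Conditional expectations tested against measurable factors *)

Section pull_out.
Context d (T : measurableType d) (R : realType) (P : {measure set T -> \bar R}).
Variables (G : set (set T)) (D : T -> R).
Hypothesis Gm : <<s G >> `<=` @measurable d T.
Hypothesis Dint : P.-integrable setT (EFin \o D).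
Hypothesis D0 : forall A, <<s G >> A -> \int[P]_(w in A) D w = 0.

Lemma measurable_fun_sub d' (T' : measurableType d') (W : T -> T') :
  measurable_fun setT (W : g_sigma_algebraType G -> T') ->
  measurable_fun setT W.
Proof. by move=> mW _ B mB; apply: Gm; exact: mW. Qed.

Import HBNNSimple.

(** Each level set of [g] lies in the generated sigma-algebra, so [D] restricted to it integrates to
    0 over [A]; a simple function combines finitely many of them. *)
Let pull_out_nnsfun (g : {nnsfun g_sigma_algebraType G >-> R}) A :
  <<s G >> A -> \int[P]_(w in A) (D w * g w) = 0.
Proof.
move=> GA; have mA : measurable A by exact: Gm.
have [s gE] : exists s : seq R,
    forall w, g w = \sum_(y <- s) y * \1_(g @^-1` [set y]) w.
  exists (finmap.enum_fset (fset_set (range g))) => w.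
  by rewrite fimfunE fsbig_finite.
have -> : \int[P]_(w in A) (D w * g w) = \int[P]_(w in A)
    (\sum_(y <- s) y * (D \_ (g @^-1` [set y])) w).
  apply: eq_Rintegral => w _; rewrite gE mulr_sumr.
  apply: eq_bigr => y _; rewrite mulrCA; congr (_ * _).
  by rewrite patchE indicE; case: ifP => _; rewrite ?mulr1 ?mulr0.
have H y : P.-integrable A (EFin \o (D \_ (g @^-1` [set y]))) /\
    \int[P]_(w in A) (D \_ (g @^-1` [set y])) w = 0.
  have Gy : <<s G >> (g @^-1` [set y]).
    have := @measurable_funPT _ _ _ _ g measurableT [set y] (measurable_set1 y).
    by rewrite setTI.
  have my : (@measurable d T) (g @^-1` [set y]) by exact: Gm.
  split.
    have : P.-integrable setT (EFin \o (D \_ (g @^-1` [set y]))).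
      rewrite -restrict_EFin; apply/(integrable_mkcond _ my).
      exact: integrableS Dint.
    exact: integrableS.
  rewrite -Rintegral_mkcondr; apply: D0.
  exact: (@measurableI _ (g_sigma_algebraType G)).
(* Additivity of the integral needs integrability, so both facts are carried through the list
   induction. *)
suff : P.-integrable A (EFin \o (fun w =>
           \sum_(y <- s) y * (D \_ (g @^-1` [set y])) w)) /\
    \int[P]_(w in A) (\sum_(y <- s) y * (D \_ (g @^-1` [set y])) w) = 0 by case.
elim: s {gE} => [|y s [IHi IH]].
  under eq_Rintegral do rewrite big_nil.
  rewrite Rintegral_cst ?mul0r//; split => //.
  rewrite [X in P.-integrable _ X](_ : _ = cst 0%E); first exact: integrable0.
  by apply/funext => w /=; rewrite big_nil.
have [Hi H0] := H y.
have yi : P.-integrable A (EFin \o (fun w => y * (D \_ (g @^-1` [set y])) w)).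
  exact: (integrableZl mA y Hi).
split.
  have -> : EFin \o (fun w =>
      \sum_(y <- y :: s) y * (D \_ (g @^-1` [set y])) w) =
    ((EFin \o (fun w => (y * (D \_ (g @^-1` [set y])) w)%R)) \+ (EFin \o (fun w =>
           \sum_(y <- s) (y * (D \_ (g @^-1` [set y])) w)%R)%R))%E.
    by apply/funext => w /=; rewrite big_cons EFinD.
  exact: integrableD.
under eq_Rintegral do rewrite big_cons.
by rewrite RintegralD// IH RintegralZl// H0 mulr0 addr0.
Qed.

(** Simple functions increase to [W]. Since [D] has no sign, the limit is taken by dominated
    convergence, with dominating function [|D W|]. *)
Let pull_out_ge0 (W : T -> R) A : (forall w, 0 <= W w) ->
  measurable_fun setT (W : g_sigma_algebraType G -> R) ->
  P.-integrable setT (EFin \o (D \* W)) ->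
  <<s G >> A -> \int[P]_(w in A) (D w * W w) = 0.
Proof.
move=> W0 mW Wint GA; have mA : measurable A by exact: Gm.
have mW' := (measurable_EFinP _ _).2 mW.
have W0' (w : g_sigma_algebraType G) : setT w -> (0 <= (EFin \o W) w)%E.
  by move=> _; rewrite lee_fin.
pose g n := nnsfun_approx measurableT mW' n.
have mD : measurable_fun setT D by exact/measurable_EFinP/(measurable_int P Dint).
have mDg n : measurable_fun A (EFin \o (D \* (g n : T -> R))).
  apply/measurable_EFinP/measurable_funTS/measurable_funM => //.
  exact: measurable_fun_sub (@measurable_funPT _ _ _ _ (g n)).
have mDW : measurable_fun A (EFin \o (D \* W)).
  exact/measurable_funTS/(measurable_int P Wint).
have [] // := @dominated_convergence _ _ _ P A mA
   (fun n => EFin \o (D \* (g n : T -> R))) (EFin \o (D \* W))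
   (abse \o (EFin \o (D \* W))).
- apply: aeW => w Aw /=.
  under eq_fun do rewrite EFinM; rewrite EFinM.
  by apply: cvgeZl => //; exact: (cvg_nnsfun_approx _ _ W0').
- by apply: integrable_abse; exact: integrableS Wint.
- apply: aeW => w n Aw /=; rewrite lee_fin !normrM ler_wpM2l//.
  rewrite !ger0_norm// -lee_fin /g nnsfun_approxE.
  exact: (@le_approx _ (g_sigma_algebraType G) _ _ _ _ _ W0').
move=> DWi _; rewrite [X in X @ \oo --> _](_ : _ = cst 0%E).
  move=> /cvg_lim => /(_ (@ereal_hausdorff _)).
  rewrite (cvg_lim (@ereal_hausdorff _) (cvg_cst _)) => H.
  by rewrite /Rintegral; move: H; rewrite /= => <-.
apply/funext => n /=; have := pull_out_nnsfun (g n) GA.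
rewrite /Rintegral => E; rewrite -[LHS]fineK ?E//.
apply: integrable_fin_num => //.
apply: le_integrable (integrableS measurableT mA (@subsetT _ _) Wint) => //.
  exact: mDg.
move=> w Aw /=; rewrite lee_fin !normrM ler_wpM2l//.
rewrite !ger0_norm// -lee_fin /g nnsfun_approxE.
exact: (@le_approx _ (g_sigma_algebraType G) _ _ _ _ _ W0').
Qed.

(** Both the positive and the negative part of [W] are bounded by [|W|], so integrability of [D W]
    passes to them. [W] itself may be unbounded, as polynomial test functions are. *)
Lemma pull_out (W : T -> R) A :
  measurable_fun setT (W : g_sigma_algebraType G -> R) ->
  P.-integrable setT (EFin \o (D \* W)) ->
  <<s G >> A -> \int[P]_(w in A) (D w * W w) = 0.
Proof.
move=> mW Wint GA; have mA : measurable A by exact: Gm.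
have mD : measurable_fun setT D by exact/measurable_EFinP/(measurable_int P Dint).
pose Wp w := Num.max (W w) 0; pose Wn w := Num.max (- W w) 0.
have mWp : measurable_fun setT (Wp : g_sigma_algebraType G -> R).
  exact: measurable_maxr.
have mWn : measurable_fun setT (Wn : g_sigma_algebraType G -> R).
  by apply: measurable_maxr => //; exact: measurableT_comp.
have dom V : measurable_fun setT (V : g_sigma_algebraType G -> R) ->
    (forall w, `|V w| <= `|W w|) -> P.-integrable setT (EFin \o (D \* V)).
  move=> mV VW; apply: le_integrable Wint => //.
    by apply/measurable_EFinP/measurable_funM => //; exact: measurable_fun_sub.
  by move=> w _ /=; rewrite lee_fin !normrM ler_wpM2l.
have Wpi : P.-integrable setT (EFin \o (D \* Wp)).
  by apply: dom => // w; rewrite /Wp; case: (leP (W w) 0) => _;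
    rewrite ?normr0 ?lexx.
have Wni : P.-integrable setT (EFin \o (D \* Wn)).
  apply: dom => // w; rewrite /Wn; case: (leP (- W w) 0) => _.
    by rewrite normr0.
  by rewrite normrN.
have WE w : W w = Wp w - Wn w.
  by rewrite /Wp /Wn; case: (leP (W w) 0); case: (leP (- W w) 0); lra.
under eq_Rintegral do rewrite WE mulrBr.
rewrite RintegralB//; [|exact: integrableS Wpi|exact: integrableS Wni].
rewrite !pull_out_ge0 ?subrr// => w.
  by rewrite /Wn le_max lexx orbT.
by rewrite /Wp le_max lexx orbT.
Qed.

End pull_out.

Section conditional_expectation.
Context d (T : measurableType d) (R : realType) (P : probability T R).
Variable G : set (set T).
Hypothesis Gm : <<s G >> `<=` @measurable d T.

Lemma condE_Rintegral (Y Z : T -> R) A : is_condE P <<s G >> Y Z -> <<s G >> A ->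
  \int[P]_(w in A) (Y w - Z w) = 0.
Proof.
move=> [Yi Zi _ YZ] GA; have mA : measurable A by exact: Gm.
rewrite RintegralB//; [|exact: integrableS Yi|exact: integrableS Zi].
by rewrite /Rintegral YZ// subrr.
Qed.

(** [pull_out] applied to [Y - Z]. Only integrals of [Z] over events are compared, so [Z] may be
    merely almost surely equal to a version of the conditional expectation, as in [condVar_mul]. *)
Lemma condE_mul (Y Z W : T -> R) A :
  P.-integrable setT (EFin \o Y) -> P.-integrable setT (EFin \o Z) ->
  (forall B, <<s G >> B -> \int[P]_(w in B) (Y w - Z w) = 0) ->
  measurable_fun setT (W : g_sigma_algebraType G -> R) ->
  P.-integrable setT (EFin \o (Y \* W)) ->
  P.-integrable setT (EFin \o (Z \* W)) -> <<s G >> A ->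
  \int[P]_(w in A) (Y w * W w) = \int[P]_(w in A) (Z w * W w).
Proof.
move=> Yi Zi YZ mW YWi ZWi GA; have mA : measurable A by exact: Gm.
apply/eqP; rewrite -subr_eq0 -RintegralB//; last 2 first.
- exact: integrableS YWi.
- exact: integrableS ZWi.
under eq_Rintegral do rewrite -mulrBl.
apply/eqP; apply: (@pull_out _ _ _ P G (fun w => Y w - Z w)) => //.
  exact: (integrableB measurableT Yi Zi).
have -> : (fun w => Y w - Z w) \* W = (fun w => Y w * W w - Z w * W w).
  by apply/funext => w /=; rewrite mulrBl.
exact: (integrableB measurableT YWi ZWi).
Qed.

Lemma condE_measurable (Y Z : T -> R) : is_condE P <<s G >> Y Z ->
  measurable_fun setT (Z : g_sigma_algebraType G -> R).
Proof. by move=> [_ _ ZG _] _ B mB; apply: ZG; exists B. Qed.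

(** The event [Z1 >= Z2] belongs to the sigma-algebra, and [|D| = 2 D 1_A - D] on it and off it, so
    [|Z1 - Z2|] has integral 0. *)
Lemma condE_unique (Y Z1 Z2 : T -> R) :
  is_condE P <<s G >> Y Z1 -> is_condE P <<s G >> Y Z2 ->
  {ae P, forall w, Z1 w = Z2 w}.
Proof.
move=> YZ1 YZ2; pose D w := Z1 w - Z2 w.
have [Yi Z1i _ _] := YZ1; have [_ Z2i _ _] := YZ2.
have Di : P.-integrable setT (EFin \o D) by exact: (integrableB measurableT Z1i Z2i).
have D0 A : <<s G >> A -> \int[P]_(w in A) D w = 0.
  move=> GA; have mA : measurable A by exact: Gm.
  have iA f : P.-integrable setT f -> P.-integrable A f by exact: integrableS.
  have := condE_Rintegral YZ1 GA; have := condE_Rintegral YZ2 GA.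
  rewrite !RintegralB//; try exact: iA.
  by move=> /subr0_eq -> /subr0_eq ->; rewrite subrr.
have mDG : measurable_fun setT (D : g_sigma_algebraType G -> R).
  by apply: measurable_funB; [exact: condE_measurable YZ1|exact: condE_measurable YZ2].
pose A : set T := [set w | 0 <= D w].
have GA : <<s G >> A.
  have -> : A = D @^-1` `[0, +oo[.
    by apply/seteqP; split => w /=; rewrite in_itv /= andbT.
  by rewrite -[X in <<s G>> X]setTI; apply: mDG.
have mA : measurable A by exact: Gm.
have GT : <<s G >> setT by exact: (@measurableT _ (g_sigma_algebraType G)).
have : \int[P]_w `|D w| = 0.
  have -> : \int[P]_w `|D w| = \int[P]_w (2 * (D \_ A) w - D w).
    apply: eq_Rintegral => w _; rewrite patchE.
    case: ifPn => [|wA].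
      by rewrite inE => wA; rewrite ger0_norm//; ring.
    (* Outside [A] the restriction takes the default value [point], which is 0 in [R]. *)
    have -> : point = 0 :> R by [].
    rewrite ltr0_norm; first by ring.
    by rewrite ltNge; apply: contra wA => D0'; rewrite inE.
  have DAi : P.-integrable setT (EFin \o (D \_ A)).
    rewrite -restrict_EFin; apply/(integrable_mkcond _ mA).
    exact: integrableS Di.
  rewrite RintegralB//; last exact: (integrableZl measurableT 2 DAi).
  by rewrite RintegralZl// -Rintegral_mkcond !D0// mulr0 subrr.
have Dn := integrable_norm Di.
rewrite /Rintegral => H.
have {}H : (\int[P]_w `|(D w)%:E| = 0)%E.
  by rewrite -[LHS]fineK ?H//; exact: integrable_fin_num.
have mD : measurable_fun setT (EFin \o D) by case/integrableP: Di.
have := (ae_eq_integral_abs P measurableT mD).1 H.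
apply: filterS => w /(_ I) [] /eqP.
by rewrite subr_eq0 => /eqP.
Qed.

(** The versions hidden in [is_condVar] need not be [Z]; by uniqueness [Y1 = Z] almost surely, so
    [V + Z ^+ 2] has the same integrals over events as [Y ^+ 2]. *)
Lemma condVar_mul (Y Z V W : T -> R) A :
  is_condE P <<s G >> Y Z -> is_condVar P <<s G >> Y V ->
  P.-integrable setT (EFin \o (fun w => V w + Z w ^+ 2)) ->
  measurable_fun setT (W : g_sigma_algebraType G -> R) ->
  P.-integrable setT (EFin \o (fun w => Y w ^+ 2 * W w)) ->
  P.-integrable setT (EFin \o (fun w => (V w + Z w ^+ 2) * W w)) ->
  <<s G >> A ->
  \int[P]_(w in A) (Y w ^+ 2 * W w) =
  \int[P]_(w in A) ((V w + Z w ^+ 2) * W w).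
Proof.
move=> YZ [Y1 [Y2 [YY1 YY2 Y2V]]] Qi mW YWi QWi GA.
have [Y2i Z2i _ _] := YY2.
apply: (condE_mul (Y := fun w => Y w ^+ 2) (Z := fun w => V w + Z w ^+ 2)) => //.
move=> B GB; have mB : measurable B by exact: Gm.
rewrite RintegralB//; [|exact: integrableS Y2i|exact: integrableS Qi].
have := condE_Rintegral YY2 GB.
rewrite RintegralB//; [|exact: integrableS Y2i|exact: integrableS Z2i].
move=> /subr0_eq ->; apply/eqP; rewrite subr_eq0; apply/eqP.
congr fine; apply: ae_eq_integral => //.
- exact: measurable_int (integrableS measurableT mB (@subsetT _ _) Z2i).
- exact: measurable_int (integrableS measurableT mB (@subsetT _ _) Qi).
have := condE_unique YZ YY1.
move: Y2V; apply: filterS2 => w H1 H2 _.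
by rewrite H2 -H1 subrK.
Qed.

End conditional_expectation.

(** * Mixed moments of a quadratic harness *)

Lemma horner1 (R : nzRingType) (x : R) : (1 : {poly R}).[x] = 1.
Proof. by rewrite -polyC1 hornerC. Qed.

Section mixed_moments.
Context d (T : measurableType d) (R : realType) (P : probability T R).
Variable X : R -> {RV P >-> R}.

Lemma sigma_of_measurable (I : set R) : sigma_of X I `<=` @measurable d T.
Proof.
apply: smallest_sub; first exact: sigma_algebra_measurable.
move=> A [t _ [B mB <-]].
exact: (@measurable_funPT _ _ _ _ (X t)).
Qed.

Lemma sigma_ofS (I J : set R) : I `<=` J -> sigma_of X I `<=` sigma_of X J.
Proof. by move=> IJ; apply: sub_sigma_algebra2; exact: bigcup_subset. Qed.

Lemma measurable_poly_sigma_of (I : set R) (f : {poly R}) t : I t ->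
  measurable_fun setT ((fun w => f.[X t w]) :
    g_sigma_algebraType (\bigcup_(t in I) g_sigma_algebra_preimage (X t)) -> R).
Proof.
move=> It.
have mX : measurable_fun setT ((X t : T -> R) :
    g_sigma_algebraType (\bigcup_(t in I) g_sigma_algebra_preimage (X t)) -> R).
  by move=> _ B mB; apply: sub_sigma_algebra; exists t => //; exists B.
exact: (measurableT_comp (@measurable_poly R f setT) mX).
Qed.

Hypothesis Hmom : forall t : R, 0 < t -> has_all_moments (X t).

Lemma integrable_poly (f : {poly R}) t : 0 < t ->
  P.-integrable setT (EFin \o (fun w => f.[X t w])).
Proof.
move=> t0; have -> : EFin \o (fun w => f.[X t w]) =
    (fun w => \sum_(i < size f) ((f`_i)%:E * (X t w ^+ i)%:E))%E.
  apply/funext => w /=; rewrite horner_coef -sumEFin.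
  by apply: eq_bigr => i _; rewrite EFinM.
apply: integrable_sum => // i _; apply: integrableZl => //.
exact: Hmom.
Qed.

(** Moments are assumed at single times only; [|ab| <= a^2 + b^2] reduces a product at two times to
    them. *)
Lemma integrable_polyM (f g : {poly R}) s t : 0 < s -> 0 < t ->
  P.-integrable setT (EFin \o (fun w => f.[X s w] * g.[X t w])).
Proof.
move=> s0 t0.
have fi := integrable_poly (f * f) s0; have gi := integrable_poly (g * g) t0.
apply: le_integrable (integrableD measurableT fi gi) => //.
  apply/measurable_EFinP/measurable_funM; apply/measurable_EFinP.
    exact: measurable_int (integrable_poly f s0).
  exact: measurable_int (integrable_poly g t0).
move=> w _ /=; rewrite lee_fin !hornerM.
set a := f.[_]; set b := g.[_].
rewrite [leRHS]ger0_norm ?addr_ge0 -?expr2 ?sqr_ge0//.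
rewrite ler_norml; apply/andP; split; nra.
Qed.

(** Testing on the event [A] turns identities between conditional expectations into identities
    between reals. *)
Definition mixed_moment (A : set T) (f : {poly R}) (s : R) (g : {poly R})
    (t : R) : R :=
  \int[P]_(w in A) (f.[X s w] * g.[X t w]).

Section linearity.
Variables (A : set T) (mA : measurable A).
Variables (s t : R) (s0 : 0 < s) (t0 : 0 < t).

Let mixed_int f g : P.-integrable A (EFin \o (fun w => f.[X s w] * g.[X t w])).
Proof. by apply: integrableS (integrable_polyM f g s0 t0). Qed.

Lemma mixedC f g : mixed_moment A f s g t = mixed_moment A g t f s.
Proof. by apply: eq_Rintegral => w _; rewrite mulrC. Qed.

Lemma mixed_same f g : mixed_moment A f t g t = mixed_moment A 1 s (f * g) t.
Proof. by apply: eq_Rintegral => w _; rewrite hornerE hornerM mul1r. Qed.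

Lemma mixedDr f g h :
  mixed_moment A f s (g + h) t = mixed_moment A f s g t + mixed_moment A f s h t.
Proof.
rewrite /mixed_moment -RintegralD//; apply: eq_Rintegral => w _.
by rewrite hornerD mulrDr.
Qed.

Lemma mixedZr c f g : mixed_moment A f s (c *: g) t = c * mixed_moment A f s g t.
Proof.
rewrite /mixed_moment -RintegralZl//; apply: eq_Rintegral => w _.
by rewrite hornerZ mulrCA.
Qed.

End linearity.

(** A list of triples (coefficient, polynomial in [X_s], polynomial in [X_u]), so that the long
    right-hand sides below are integrated termwise at once. *)
Definition mixed_comb (l : seq (R * {poly R} * {poly R})) (s u : R) (w : T) : R :=
  \sum_(c <- l) c.1.1 * (c.1.2.[X s w] * c.2.[X u w]).

Lemma integrable_mixed_comb l s u : 0 < s -> 0 < u ->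
  P.-integrable setT (EFin \o mixed_comb l s u).
Proof.
move=> s0 u0; have -> : EFin \o mixed_comb l s u = (fun w =>
    \sum_(c <- l) ((c.1.1)%:E * (c.1.2.[X s w] * c.2.[X u w])%R%:E))%E.
  by apply/funext => w /=; rewrite -sumEFin.
by apply: integrable_sum => // c _; apply: integrableZl => //; exact: integrable_polyM.
Qed.

Lemma Rintegral_mixed_comb A l s u : measurable A -> 0 < s -> 0 < u ->
  \int[P]_(w in A) mixed_comb l s u w =
  \sum_(c <- l) c.1.1 * mixed_moment A c.1.2 s c.2 u.
Proof.
move=> mA s0 u0.
have iA f : P.-integrable setT f -> P.-integrable A f by exact: integrableS.
elim: l => [|c l IH].
  rewrite big_nil; under eq_Rintegral do rewrite /mixed_comb big_nil.
  by rewrite Rintegral_cst ?mul0r.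
have i0 := iA _ (integrable_polyM c.1.2 c.2 s0 u0).
rewrite big_cons -IH -RintegralZl// -RintegralD//; last 2 first.
- exact: (integrableZl mA c.1.1 i0).
- by apply: iA; exact: integrable_mixed_comb.
by apply: eq_Rintegral => w _; rewrite /mixed_comb big_cons.
Qed.

Variables q eta theta sigma tau : R.
Hypothesis Xqh : quadratic_harness X q eta theta sigma tau.

Section harness.
Variables (s t u : R) (s0 : 0 < s) (st : s < t) (tu : t < u).
Variables (A : set T) (g : {poly R}).
Hypothesis FA : past_future X s u A.

Let t0 : 0 < t. Proof. exact: lt_trans st. Qed.
Let u0 : 0 < u. Proof. exact: lt_trans tu. Qed.
Let mA : measurable A. Proof. exact: sigma_of_measurable FA. Qed.
Let mg : measurable_fun setT ((fun w => g.[X u w]) :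
    g_sigma_algebraType (\bigcup_(t in [set t | 0 < t <= s \/ u <= t])
      g_sigma_algebra_preimage (X t)) -> R).
Proof. by apply: measurable_poly_sigma_of; right => /=. Qed.

Lemma mixed_harness :
  mixed_moment A 'X t g u =
  (u - t) / (u - s) * mixed_moment A 'X s g u
  + (t - s) / (u - s) * mixed_moment A 1 s ('X * g) u.
Proof.
have [_ _ H _] := Xqh; have C := H s t u s0 st tu; have [Yi Zi _ _] := C.
rewrite /mixed_moment; under eq_Rintegral do rewrite hornerX.
pose l : seq (R * {poly R} * {poly R}) :=
  [:: ((u - t) / (u - s), 'X, g); ((t - s) / (u - s), 1, 'X * g)].
have E w : ((u - t) / (u - s) * X s w + (t - s) / (u - s) * X u w) * g.[X u w] =
    mixed_comb l s u w.
  by rewrite /mixed_comb !big_cons big_nil /= !hornerM !hornerX horner1; ring.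
rewrite (condE_mul (@sigma_of_measurable _) Yi Zi
  (fun B FB => condE_Rintegral (@sigma_of_measurable _) C FB) mg _ _ FA).
- under eq_Rintegral do rewrite E.
  by rewrite Rintegral_mixed_comb// !big_cons big_nil addr0.
- by have := integrable_polyM 'X g t0 u0; under eq_fun do rewrite /= hornerX.
- have := integrable_mixed_comb l s0 u0; congr (P.-integrable _ _).
  by apply/funext => w /=; rewrite -E.
Qed.

Let N := u * (1 + sigma * s) + tau - q * s.
Let K := (u - t) * (t - s) / N.
Let a := (u - t) / (u - s).
Let b := (t - s) / (u - s).
Let h := u - s.

(** The conditional second moment is the conditional variance plus the square of the linear
    conditional mean; expanding [Delta] and [tDelta] leaves six monomials in [X_s] and [X_u]. *)
Lemma mixed_variance :
  mixed_moment A 'X^2 t g u =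
    (a ^+ 2 + K * (sigma * u ^+ 2 + tau + (1 - q) * u) / h ^+ 2)
      * mixed_moment A 'X^2 s g u
  + (2 * a * b - K * (2 * sigma * u * s + 2 * tau + (1 - q) * (u + s)) / h ^+ 2)
      * mixed_moment A 'X s ('X * g) u
  + (b ^+ 2 + K * (sigma * s ^+ 2 + tau + (1 - q) * s) / h ^+ 2)
      * mixed_moment A 1 s ('X * ('X * g)) u
  + K * (eta * u - theta) / h * mixed_moment A 'X s g u
  + K * (theta - eta * s) / h * mixed_moment A 1 s ('X * g) u
  + K * mixed_moment A 1 s g u.
Proof.
have [_ _ H HV] := Xqh; have C := H s t u s0 st tu.
have V := HV s t u s0 st tu.
rewrite {1}/mixed_moment; under eq_Rintegral do rewrite hornerXn.
(* [l 1] represents the conditional second moment itself, whose integrability is needed separately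
   from that of its product with [g(X_u)]. *)
pose l (g : {poly R}) : seq (R * {poly R} * {poly R}) := [::
  (a ^+ 2 + K * (sigma * u ^+ 2 + tau + (1 - q) * u) / h ^+ 2, 'X^2, g);
  (2 * a * b - K * (2 * sigma * u * s + 2 * tau + (1 - q) * (u + s)) / h ^+ 2,
    'X, 'X * g);
  (b ^+ 2 + K * (sigma * s ^+ 2 + tau + (1 - q) * s) / h ^+ 2, 1, 'X * ('X * g));
  (K * (eta * u - theta) / h, 'X, g);
  (K * (theta - eta * s) / h, 1, 'X * g);
  (K, 1, g)].
set Vf := (Vf in is_condVar _ _ _ Vf) in V.
have E1 w : Vf w + (a * X s w + b * X u w) ^+ 2 = mixed_comb (l 1) s u w.
  rewrite /Vf /Delta /tDelta /mixed_comb !big_cons big_nil /= /K /N /a /b /h.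
  move: ((u - t) * (t - s) / _) => K0.
  rewrite !hornerXn !hornerM !hornerX !horner1.
  by field; rewrite subr_eq0 gt_eqF// (lt_trans st).
have E w : (Vf w + (a * X s w + b * X u w) ^+ 2) * g.[X u w] =
    mixed_comb (l g) s u w.
  rewrite E1 /mixed_comb !big_cons big_nil /= !hornerXn !hornerM !horner1 !hornerX.
  ring.
rewrite (condVar_mul (@sigma_of_measurable _) C V _ mg _ _ FA).
- under eq_Rintegral do rewrite E.
  by rewrite Rintegral_mixed_comb// !big_cons big_nil /=; ring.
- have := integrable_mixed_comb (l 1) s0 u0; congr (P.-integrable _ _).
  by apply/funext => w /=; rewrite -E1.
- by have := integrable_polyM 'X^2 g t0 u0; under eq_fun do rewrite /= hornerXn.
- have := integrable_mixed_comb (l g) s0 u0; congr (P.-integrable _ _).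
  by apply/funext => w /=; rewrite -E.
Qed.

End harness.
End mixed_moments.

(** * The Jacobi operators *)

Section jacobi.
Context {R : realType}.
Variables (rho eta theta sigma tau : R).

(* The value at [1] is [omega_coef] with the common factor [1 - 2 rho] of its
   numerator and denominator cancelled; that factor may vanish. *)
Definition om (n : nat) : R :=
  if n == 1%N then (1 - rho) ^- 2 else omega_coef rho eta theta sigma tau n.

(** The part of the recurrence proportional to [t]; [opy] is the part free of [t]. At [n = 0] the
    truncated [e n.-1] reads [e 0], but its factor [om 0] is 0. *)
Definition opx (e : nat -> R) (n : nat) : R :=
  n%:R * sigma * e n.+1 + gamma_coef rho eta theta sigma n * e n
  + om n * (1 + (n%:R - 2) * rho) * e n.-1.

Definition opy (e : nat -> R) (n : nat) : R :=
  (1 + (n%:R - 1) * rho) * e n.+1 + delta_coef rho eta theta tau n * e n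
  + om n * (tau * (n%:R - 1)) * e n.-1.

Hypothesis rho_ge0 : 0 <= rho.
Hypothesis rho_lt1 : rho < 1.
Hypothesis st : sigma * tau = rho ^+ 2.

Local Notation q := (1 - 2 * rho).
Local Notation g := (gamma_coef rho eta theta sigma).
Local Notation d := (delta_coef rho eta theta tau).

(** * Nonvanishing denominators and the q-commutation relation *)

Lemma affine_rho_neq0 (c : R) : -1 <= c -> 1 + c * rho != 0.
Proof.
move=> c1; apply: lt0r_neq0.
have : 0 <= (c + 1) * rho by apply: mulr_ge0 => //; rewrite -lerBlDr sub0r.
rewrite mulrDl mul1r; move: rho_lt1; lra.
Qed.

Lemma onem_rho_neq0 : 1 - rho != 0.
Proof. by rewrite subr_eq0 gt_eqF. Qed.

Lemma oneD_rho_neq0 : 1 + rho != 0.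
Proof. by apply: lt0r_neq0; rewrite ltr_wpDr. Qed.

Lemma gamma_coef0 : g 0%N = 0. Proof. by rewrite /gamma_coef !mul0r. Qed.
Lemma delta_coef0 : d 0%N = 0. Proof. by rewrite /delta_coef !mul0r. Qed.
Lemma om0 : om 0%N = 0.
Proof. by rewrite /om /= /omega_coef !mul0r addr0. Qed.

Lemma gamma_coef1 : g 1%N = (eta + theta * sigma) / ((1 - rho) * (1 + rho)).
Proof.
by rewrite /gamma_coef /=; field; rewrite oneD_rho_neq0 onem_rho_neq0.
Qed.

Lemma delta_coef1 : d 1%N = (theta + eta * tau) / ((1 - rho) * (1 + rho)).
Proof.
by rewrite /delta_coef /=; field; rewrite oneD_rho_neq0 onem_rho_neq0.
Qed.

(* [band2], [band1], [band0], [bandN1], [bandN2] compare the coefficients of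
   [e n.+2], ..., [e (n - 2)] in [opxy_commutation]. *)
Lemma band1 n :
  g n.+1 * (1 + (n%:R - 1) * rho) + n%:R * sigma * d n
  - q * (d n.+1 * (n%:R * sigma) + (1 + (n%:R - 1) * rho) * g n)
  = eta * (1 + (n%:R - 1) * rho) + theta * (n%:R * sigma)
  + sigma * (d n.+1 + d n) * (1 + (n%:R - 1) * rho)
  + tau * (g n.+1 + g n) * (n%:R * sigma).
Proof.
(* Index 0 is separate: there [gamma_coef] and [delta_coef] have the denominator factor [1 - 3 rho],
   which may vanish. *)
case: n => [|n].
  rewrite gamma_coef0 delta_coef0 gamma_coef1 delta_coef1.
  by field: st; rewrite oneD_rho_neq0 onem_rho_neq0.
have n0 := ler0n R n.
rewrite /gamma_coef /delta_coef /=.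
by field: st; rewrite onem_rho_neq0 !affine_rho_neq0 //; lra.
Qed.

Lemma bandN1 n :
  d n.+1 * (1 + (n.+1%:R - 2) * rho) + tau * (n.+1%:R - 1) * g n
  - q * (g n.+1 * (tau * (n.+1%:R - 1)) + (1 + (n.+1%:R - 2) * rho) * d n)
  = eta * (tau * (n.+1%:R - 1)) + theta * (1 + (n.+1%:R - 2) * rho)
  + sigma * (d n.+1 + d n) * (tau * (n.+1%:R - 1))
  + tau * (g n.+1 + g n) * (1 + (n.+1%:R - 2) * rho).
Proof.
case: n => [|n].
  rewrite gamma_coef0 delta_coef0 gamma_coef1 delta_coef1.
  by field: st; rewrite oneD_rho_neq0 onem_rho_neq0.
have n0 := ler0n R n.
rewrite /gamma_coef /delta_coef /=.
by field: st; rewrite onem_rho_neq0 !affine_rho_neq0 //; lra.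
Qed.

Lemma band0 n :
  (1 + (n%:R - 1) * rho) * (om n.+1 * (1 + (n.+1%:R - 2) * rho)) + d n * g n
  + om n * (tau * (n%:R - 1)) * ((n%:R - 1) * sigma)
  - q * (n%:R * sigma * (om n.+1 * (tau * (n.+1%:R - 1))) + g n * d n
     + om n * (1 + (n%:R - 2) * rho) * (1 + (n%:R - 2) * rho))
  = 1 + eta * d n + theta * g n
  + sigma * ((1 + (n%:R - 1) * rho) * (om n.+1 * (tau * (n.+1%:R - 1))) + d n ^+ 2
     + om n * (tau * (n%:R - 1)) * (1 + (n%:R - 2) * rho))
  + tau * (n%:R * sigma * (om n.+1 * (1 + (n.+1%:R - 2) * rho)) + g n ^+ 2
     + om n * (1 + (n%:R - 2) * rho) * ((n%:R - 1) * sigma)).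
Proof.
(* [field] modulo [st] is incomplete here, hence the elimination of [tau]. *)
have rho0 : sigma = 0 -> rho = 0.
  by move=> s0; apply/eqP; rewrite -sqrf_eq0 -st s0 mul0r.
have tauE : sigma != 0 -> tau = rho ^+ 2 / sigma.
  by move=> sN0; apply: (canRL (mulfK sN0)); rewrite mulrC.
(* Indices 0 and 1 are separate because they involve [om 1], which has its own formula. *)
case: n => [|[|n]].
- rewrite gamma_coef0 delta_coef0 om0 /om /=.
  by field: st; exact: onem_rho_neq0.
- rewrite gamma_coef1 delta_coef1 /om /= /omega_coef.
  have [s0|sN0] := eqVneq sigma 0; first by rewrite (rho0 s0) s0; field.
  rewrite (tauE sN0); field.
  by rewrite sN0 oneD_rho_neq0 onem_rho_neq0 !affine_rho_neq0 //; lra.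
have n0 := ler0n R n.
rewrite /om /= /omega_coef /gamma_coef /delta_coef /=.
have [s0|sN0] := eqVneq sigma 0; first by rewrite (rho0 s0) s0; field.
rewrite (tauE sN0); field.
by rewrite sN0 onem_rho_neq0 !affine_rho_neq0 //; lra.
Qed.

Lemma band2 n :
  n.+1%:R * sigma * (1 + (n%:R - 1) * rho)
  - q * ((1 + (n.+1%:R - 1) * rho) * (n%:R * sigma))
  = sigma * ((1 + (n.+1%:R - 1) * rho) * (1 + (n%:R - 1) * rho))
  + tau * ((n.+1%:R * sigma) * (n%:R * sigma)).
Proof. by ring: st. Qed.

Lemma bandN2 n :
  (1 + (n%:R - 2) * rho) * (tau * (n.+1%:R - 1))
  - q * (tau * (n%:R - 1) * (1 + (n.+1%:R - 2) * rho))
  = sigma * (tau * (n%:R - 1) * (tau * (n.+1%:R - 1)))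
  + tau * ((1 + (n%:R - 2) * rho) * (1 + (n.+1%:R - 2) * rho)).
Proof. by ring: st. Qed.

(** Both sides are five-diagonal. Row [n] is the sum of the band identities, weighted by the entries
    of [e] and, below the diagonal, by the factors [om] crossed; row 0 has only the three upper
    bands. *)
Lemma opxy_commutation e n :
  opy (opx e) n - q * opx (opy e) n =
  e n + eta * opy e n + theta * opx e n + sigma * opy (opy e) n
  + tau * opx (opx e) n.
Proof.
case: n => [|n].
  have B2 := congr1 ( *%R (e 2%N)) (band2 0).
  have B1 := congr1 ( *%R (e 1%N)) (band1 0).
  have B0 := congr1 ( *%R (e 0%N)) (band0 0).
  move: B2 B1 B0; rewrite /opx /opy om0 gamma_coef0 delta_coef0 /=.
  lra.
have B2 := congr1 ( *%R (e n.+3)) (band2 n.+1).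
have B1 := congr1 ( *%R (e n.+2)) (band1 n.+1).
have B0 := congr1 ( *%R (e n.+1)) (band0 n.+1).
have BN1 := congr1 ( *%R (om n.+1 * e n)) (bandN1 n).
have BN2 := congr1 ( *%R (om n.+1 * om n * e n.-1)) (bandN2 n).
move: B2 B1 B0 BN1 BN2; rewrite /opx /opy /=.
lra.
Qed.

Definition upper (n : nat) (t : R) : R := 1 + (n%:R - 1) * rho + n%:R * sigma * t.
Definition diag (n : nat) (t : R) : R := g n * t + d n.
Definition lower (n : nat) (t : R) : R :=
  om n * ((1 + (n%:R - 2) * rho) * t + tau * (n%:R - 1)).

Definition jacobi (t : R) (e : nat -> R) (n : nat) : R := t * opx e n + opy e n.

Lemma jacE t e n :
  jacobi t e n = upper n t * e n.+1 + diag n t * e n + lower n t * e n.-1.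
Proof. by rewrite /jacobi /opx /opy /upper /diag /lower; ring. Qed.

(** Row [k] reads no entry beyond [k.+1]. In the induction this isolates the one moment not yet
    known to be constant in time. *)
Lemma jac_perturb t e e' k : (forall j, (j <= k)%N -> e' j = e j) ->
  jacobi t e' k = jacobi t e k + upper k t * (e' k.+1 - e k.+1).
Proof.
by move=> ee'; rewrite !jacE (ee' k)// (ee' k.-1) ?leq_pred//; ring.
Qed.

Lemma eq_jac t e e' k : (forall j, (j <= k.+1)%N -> e' j = e j) ->
  jacobi t e' k = jacobi t e k.
Proof.
move=> ee'; rewrite (@jac_perturb t e) ?ee' ?subrr ?mulr0 ?addr0// => j jk.
by rewrite ee'// leqW.
Qed.

Lemma jac2_perturb t e e' k : (forall j, (j <= k.+1)%N -> e' j = e j) ->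
  jacobi t (jacobi t e') k =
  jacobi t (jacobi t e) k + upper k t * upper k.+1 t * (e' k.+2 - e k.+2).
Proof.
move=> ee'; rewrite (@jac_perturb t (jacobi t e)) => [|j jk].
  by rewrite (@jac_perturb t e e' k.+1)//; ring.
by apply: eq_jac => i ij; rewrite ee'// (leq_trans ij).
Qed.

Lemma jac_jac t u e k :
  jacobi u (jacobi t e) k = u * t * opx (opx e) k + u * opx (opy e) k
                      + t * opy (opx e) k + opy (opy e) k.
Proof. by rewrite /jacobi /opx /opy /=; ring. Qed.

Lemma upper_gt0 n t : 0 < t -> 0 <= sigma -> 0 < upper n t.
Proof.
move=> t0 s0; rewrite /upper ltr_wpDr//; first by rewrite !mulr_ge0// ltW.
case: n => [|n]; first by rewrite sub0r mulN1r subr_gt0.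
by rewrite -natr1 addrK ltr_wpDr// mulr_ge0.
Qed.

(* The conditional variance formula with [X_s], [X_t], [X_u] replaced by
   [jacobi s], [jacobi t], [jacobi u]; these do not commute, and the formula
   survives exactly because of the q-commutation relation. *)
Lemma jac_variance s t u e k :
  let N := u * (1 + sigma * s) + tau - q * s in
  let K := (u - t) * (t - s) / N in
  let a := (u - t) / (u - s) in
  let b := (t - s) / (u - s) in
  let h := u - s in
  h != 0 -> N != 0 ->
  jacobi t (jacobi t e) k =
    (a ^+ 2 + K * (sigma * u ^+ 2 + tau + (1 - q) * u) / h ^+ 2)
      * jacobi s (jacobi s e) k
  + (2 * a * b - K * (2 * sigma * u * s + 2 * tau + (1 - q) * (u + s)) / h ^+ 2)
      * jacobi u (jacobi s e) k
  + (b ^+ 2 + K * (sigma * s ^+ 2 + tau + (1 - q) * s) / h ^+ 2)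
      * jacobi u (jacobi u e) k
  + K * (eta * u - theta) / h * jacobi s e k
  + K * (theta - eta * s) / h * jacobi u e k
  + K * e k.
Proof.
move=> N K a b h h0 N0; rewrite !jac_jac /jacobi.
have C := opxy_commutation e k.
have -> : opy (opx e) k = q * opx (opy e) k + e k + eta * opy e k
    + theta * opx e k + sigma * opy (opy e) k + tau * opx (opx e) k.
  by move: C; lra.
move: (opx (opy e) k) (opx (opx e) k) (opy (opy e) k) (opx e k) (opy e k) (e k).
move=> xy xx yy x y z; rewrite /K /a /b; move: h0 N0; rewrite /h /N => h0 N0.
by field; rewrite N0 h0.
Qed.

(** The coefficient of [X_u^2] in the conditional second moment, the only term through which the
    unknown moment at time [u] enters. *)
Lemma variance_coef s t u :
  let N := u * (1 + sigma * s) + tau - q * s in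
  let K := (u - t) * (t - s) / N in
  let b := (t - s) / (u - s) in
  let h := u - s in
  h != 0 -> N != 0 ->
  b ^+ 2 + K * (sigma * s ^+ 2 + tau + (1 - q) * s) / h ^+ 2 =
  b * (t * (1 + sigma * s) + tau - q * s) / N.
Proof.
move=> N K b h h0 N0; rewrite /K /b; move: h0 N0; rewrite /h /N => h0 N0.
by field; rewrite N0 h0.
Qed.

(** The determinant of the two linear relations solved in [martingale_step]. *)
Lemma upper_det k s t u :
  upper k t * (u * (1 + sigma * s) + tau - q * s)
  - upper k u * (t * (1 + sigma * s) + tau - q * s)
  = (u - t) * (1 - rho) * upper k.+1 s.
Proof. by rewrite /upper -natr1; ring: st. Qed.

(** * The polynomials defined by the recurrence *)

Fixpoint mpoly_pair (t : R) (n : nat) : {poly R} * {poly R} :=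
  if n is m.+1 then
    let: (p, p') := mpoly_pair t m in
    (p', (upper m.+1 t)^-1 *:
           (('X - (diag m.+1 t)%:P) * p' - lower m.+1 t *: p))
  else ((1 - rho)%:P, 'X).

(* With [p_0] rescaled to [1 - rho], the general form of the recurrence also
   covers the two initial steps. *)
Definition mpol (n : nat) (t : R) : {poly R} := (mpoly_pair t n).1.

Lemma mpol0 t : mpol 0 t = (1 - rho)%:P. Proof. by []. Qed.

Lemma mpol1 t : mpol 1 t = 'X. Proof. by []. Qed.

Lemma mpolSS n t : mpol n.+2 t = (upper n.+1 t)^-1 *:
  (('X - (diag n.+1 t)%:P) * mpol n.+1 t - lower n.+1 t *: mpol n t).
Proof. by rewrite /mpol /=; case: (mpoly_pair t n). Qed.

Lemma mpol_rec n t : 0 < t -> 0 <= sigma ->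
  'X * mpol n t = upper n t *: mpol n.+1 t + diag n t *: mpol n t
                  + lower n t *: mpol n.-1 t.
Proof.
move=> t0 s0; case: n => [|n].
  rewrite /upper /diag /lower gamma_coef0 delta_coef0 om0 mpol0 mpol1.
  rewrite !mul0r !addr0 !scale0r !addr0 sub0r mulN1r -mul_polyC mulrC.
  by [].
rewrite mpolSS scalerA divff ?gt_eqF ?upper_gt0// scale1r /=.
by rewrite mulrBl mul_polyC [_ - _ + diag _ _ *: _]addrAC !subrK.
Qed.

Lemma size_mpol n t : 0 < t -> 0 <= sigma -> size (mpol n t) = n.+1.
Proof.
move=> t0 s0; have [H _] : size (mpol n t) = n.+1 /\ size (mpol n.+1 t) = n.+2.
  elim: n => [|n [IH1 IH2]].
    by rewrite mpol0 mpol1 size_polyX size_polyC onem_rho_neq0.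
  split=> //; rewrite mpolSS size_scale ?invr_eq0 ?gt_eqF ?upper_gt0//.
  rewrite size_polyDl ?size_polyN.
    by rewrite size_monicM ?monicXsubC -?size_poly_gt0 ?IH2// size_XsubC.
  rewrite size_monicM ?monicXsubC -?size_poly_gt0 ?IH2// size_XsubC.
  by rewrite (leq_ltn_trans (size_scale_leq _ _))// IH1.
exact: H.
Qed.

End jacobi.

(** * The martingale property and orthogonality *)

Section martingale.
Context d (T : measurableType d) (R : realType) (P : probability T R).
Variable X : R -> {RV P >-> R}.
Variables rho eta theta sigma tau : R.
Local Notation q := (1 - 2 * rho).
Hypothesis Hmom : forall t : R, 0 < t -> has_all_moments (X t).
Hypothesis Xqh : quadratic_harness X q eta theta sigma tau.
Hypothesis rho_ge0 : 0 <= rho.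
Hypothesis rho_lt1 : rho < 1.
Hypothesis rho2 : sigma * tau = rho ^+ 2.
Hypothesis sigma_ge0 : 0 <= sigma.
Hypothesis tau_ge0 : 0 <= tau.

Local Notation p := (mpol rho eta theta sigma tau).
Local Notation jac := (jacobi rho eta theta sigma tau).
Local Notation U := (upper rho sigma).
Local Notation mixed := (mixed_moment X).

Let U0 n t : 0 < t -> 0 < U n t.
Proof. by move=> t0; exact: upper_gt0. Qed.

Lemma mixed_rec A f s k u : measurable A -> 0 < s -> 0 < u ->
  mixed A f s ('X * p k u) u = jac u (fun j => mixed A f s (p j u) u) k.
Proof.
move=> mA s0 u0; rewrite mpol_rec// jacE !(mixedDr Hmom)//.
by rewrite !(mixedZr Hmom).
Qed.

Lemma mixed_rec2 A s k u : measurable A -> 0 < s -> 0 < u ->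
  mixed A 1 s ('X * ('X * p k u)) u =
  jac u (jac u (fun j => mixed A 1 s (p j u) u)) k.
Proof.
move=> mA s0 u0; rewrite -(mixed_same _ _ s) mixed_rec//.
by apply: eq_jac => j _; rewrite (mixed_same _ _ s) mixed_rec.
Qed.

Definition martingale_at (n : nat) := forall (s t : R) A,
  0 < s -> s < t -> past X s A -> mixed A 1 s (p n t) t = mixed A 1 s (p n s) s.

Lemma past_measurable s A : past X s A -> measurable A.
Proof. exact: sigma_of_measurable. Qed.

Lemma past_sub s t : s <= t -> past X s `<=` past X t.
Proof.
move=> st; apply: sigma_ofS => r /= /andP[r0 rs].
by rewrite r0 (le_trans rs).
Qed.

Lemma past_sub_past_future s u : past X s `<=` past_future X s u.
Proof. by apply: sigma_ofS => r /= rs; left. Qed.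

(** A polynomial in [X_s] is measurable for the past of [s], so it can be pulled out. This moves
    [p k u] from time [u] back to an earlier time. *)
Lemma martingale_mul n s t A f : martingale_at n -> 0 < s -> s < t ->
  past X s A -> mixed A f s (p n t) t = mixed A f s (p n s) s.
Proof.
move=> M s0 st FA; have t0 : 0 < t by exact: lt_trans st.
rewrite /mixed_moment.
under eq_Rintegral do rewrite mulrC.
under [RHS]eq_Rintegral do rewrite mulrC.
apply: (condE_mul (@sigma_of_measurable _ _ _ _ X [set t | 0 < t <= s])) FA.
- exact: integrable_poly.
- exact: integrable_poly.
- move=> B FB; have mB := past_measurable FB.
  have iB f' r : 0 < r -> P.-integrable B (EFin \o (fun w => f'.[X r w])).
    by move=> r0; apply: integrableS (integrable_poly Hmom f' r0).
  rewrite RintegralB//; [|exact: iB|exact: iB].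
  have := M s t B s0 st FB; rewrite /mixed_moment.
  under eq_Rintegral do rewrite horner1 mul1r.
  under [X in _ = X -> _]eq_Rintegral do rewrite horner1 mul1r.
  by move=> ->; rewrite subrr.
- by apply: measurable_poly_sigma_of => /=; rewrite s0 lexx.
- exact: integrable_polyM.
- exact: integrable_polyM.
Qed.

(** * The induction step on the degree *)

Section step.
Variables (s : R) (A : set T).
Hypothesis s0 : 0 < s.
Hypothesis FA : past X s A.
Let mA : measurable A. Proof. exact: past_measurable FA. Qed.
Let e (t : R) (j : nat) : R := mixed A 1 s (p j t) t.

(** With [e s] in place of [e t] and [e u] the integrated harness equation holds because [jacobi] is
    affine in time; only the perturbations of the top entry survive. *)
Lemma harness_step k t u : s < t -> t < u ->
  (forall j, (j <= k)%N -> martingale_at j) ->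
  U k t * (e t k.+1 - e s k.+1) =
  (t - s) / (u - s) * (U k u * (e u k.+1 - e s k.+1)).
Proof.
move=> st tu M; have t0 := lt_trans s0 st; have u0 := lt_trans t0 tu.
have su := lt_trans st tu.
have et r : s < r -> forall j, (j <= k)%N -> e r j = e s j.
  by move=> sr j jk; apply: M.
have := mixed_harness Hmom Xqh s0 st tu (p k u) (@past_sub_past_future s u A FA).
rewrite (martingale_mul _ (M k (leqnn k)) t0 tu (past_sub (ltW st) FA)).
rewrite (martingale_mul _ (M k (leqnn k)) s0 su FA).
rewrite (mixed_same _ _ s t 'X) (mixed_same _ _ s s 'X) !mixed_rec// -!/(e _).
rewrite (jac_perturb _ _ _ _ _ _ (et t st)) (jac_perturb _ _ _ _ _ _ (et u su)).
rewrite /jacobi => H.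
have h0 : u - s != 0 by rewrite subr_eq0 gt_eqF.
move: H; move: (opx _ _ _ _ _ _ _) (opy _ _ _ _ _ _ _) => x y H.
have -> : U k t * (e t k.+1 - e s k.+1) =
  (t * x + y + U k t * (e t k.+1 - e s k.+1)) - (t * x + y) by ring.
by rewrite H; field.
Qed.

Lemma variance_step k t u : s < t -> t < u ->
  (forall j, (j <= k.+1)%N -> martingale_at j) ->
  let N := u * (1 + sigma * s) + tau - q * s in
  N != 0 ->
  U k t * U k.+1 t * (e t k.+2 - e s k.+2) =
  (t - s) / (u - s) * (t * (1 + sigma * s) + tau - q * s) / N
    * (U k u * U k.+1 u * (e u k.+2 - e s k.+2)).
Proof.
move=> st tu M N N0; have t0 := lt_trans s0 st; have u0 := lt_trans t0 tu.
have su := lt_trans st tu; have h0 : u - s != 0 by rewrite subr_eq0 gt_eqF.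
have et r : s < r -> forall j, (j <= k.+1)%N -> e r j = e s j.
  by move=> sr j jk; apply: M.
have Mk := M k (leqnSn k).
have H := mixed_variance Hmom Xqh s0 st tu (p k u) (@past_sub_past_future s u A FA).
have L : mixed A 'X^2 t (p k u) u = jac t (jac t (e t)) k.
  rewrite (martingale_mul _ Mk t0 tu (past_sub (ltW st) FA)).
  by rewrite (mixed_same _ _ s) expr2 -mulrA mixed_rec2.
have R1 : mixed A 'X^2 s (p k u) u = jac s (jac s (e s)) k.
  rewrite (martingale_mul _ Mk s0 su FA).
  by rewrite (mixed_same _ _ s) expr2 -mulrA mixed_rec2.
have R2 : mixed A 'X s ('X * p k u) u = jac u (jac s (e s)) k.
  rewrite mixed_rec//; apply: eq_jac => j jk.
  by rewrite (martingale_mul _ (M j jk) s0 su FA) (mixed_same _ _ s) mixed_rec.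
have R3 : mixed A 1 s ('X * ('X * p k u)) u = jac u (jac u (e u)) k.
  by rewrite mixed_rec2.
have R4 : mixed A 'X s (p k u) u = jac s (e s) k.
  by rewrite (martingale_mul _ Mk s0 su FA) (mixed_same _ _ s) mixed_rec.
have R5 : mixed A 1 s ('X * p k u) u = jac u (e s) k.
  by rewrite mixed_rec//; apply: eq_jac => j jk; apply: M.
have R6 : mixed A 1 s (p k u) u = e s k by exact: Mk.
rewrite L R1 R2 R3 R4 R5 R6 in H.
rewrite (jac2_perturb _ _ _ _ _ _ (et t st)) in H.
rewrite (jac2_perturb _ _ _ _ _ _ (et u su)) in H.
have V := jac_variance eta theta rho_ge0 rho_lt1 rho2 t (e s) k h0 N0.
have C := variance_coef t h0 N0.
rewrite -C -[LHS](addKr (jac t (jac t (e s)) k)) H {}V.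
move: (jac s (jac s _) k) (jac u (jac s _) k) (jac u (jac u _) k).
by move: (jac s _ k) (jac u _ k) ((u - t) * (t - s) / _) => *; ring.
Qed.

Lemma martingale_step k t u : s < t -> t < u ->
  (forall j, (j <= k.+1)%N -> martingale_at j) -> e u k.+2 = e s k.+2.
Proof.
move=> st tu M; have t0 := lt_trans s0 st; have u0 := lt_trans t0 tu.
have su := lt_trans st tu.
(* As [q = 1 - 2 rho], this is [(u - s) + sigma s u + tau + 2 rho s]. *)
have N0 : 0 < u * (1 + sigma * s) + tau - q * s.
  have : 0 <= u * (sigma * s) by rewrite !mulr_ge0// ltW.
  have : 0 <= rho * s by rewrite mulr_ge0// ltW.
  by move: tau_ge0 su; lra.
have h0 : 0 < u - s by rewrite subr_gt0.
have E1 := harness_step st tu M.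
have E2 := variance_step st tu M (lt0r_neq0 N0).
have Det := upper_det rho2 k s t u.
set N := u * _ + _ - _ in N0 E2 Det; set Nt := t * _ + _ - _ in E2 Det.
(* The harness relation, taken one degree higher than the variance relation, eliminates the unknown
   at time [t]. *)
rewrite -mulrA E1 in E2.
set D := e u k.+2 - _ in E2.
have {}E2 : (t - s) / (u - s) / N * U k.+1 u * D * (U k t * N - U k u * Nt) = 0.
  have -> : (t - s) / (u - s) / N * U k.+1 u * D * (U k t * N - U k u * Nt) =
    U k t * ((t - s) / (u - s) * (U k.+1 u * D))
    - (t - s) / (u - s) * Nt / N * (U k u * U k.+1 u * D).
    by field; rewrite !gt_eqF.
  by rewrite E2 subrr.
have F1 : 0 < (t - s) / (u - s) / N * U k.+1 u.
  by rewrite mulr_gt0 ?U0// !divr_gt0// subr_gt0.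
have F2 : 0 < (u - t) * (1 - rho) * U k.+1 s.
  by rewrite !mulr_gt0 ?U0// subr_gt0.
move/eqP: E2; rewrite Det mulf_eq0 (gt_eqF F2) orbF mulf_eq0 (gt_eqF F1) /=.
by rewrite subr_eq0 => /eqP.
Qed.

End step.

(** Cauchy-Schwarz with a free weight [c], chosen later to balance a second moment at a large or a
    small time. *)
Lemma mixed_bound A f s g t c : measurable A -> 0 < s -> 0 < t -> 0 < c ->
  `|mixed A f s g t| <=
  (mixed setT f s f s / c + c * mixed setT g t g t) / 2.
Proof.
move=> mA s0 t0 c0.
have fg := integrable_polyM Hmom f g s0 t0.
have fgA : P.-integrable A (EFin \o (fun w => f.[X s w] * g.[X t w])).
  exact: integrableS fg.
have ff := integrable_polyM Hmom f f s0 s0; have gg := integrable_polyM Hmom g g t0 t0.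
have ff' := integrableZl measurableT (c^-1 / 2) ff.
have gg' := integrableZl measurableT (c / 2) gg.
apply: le_trans (le_normr_Rintegral mA fgA) _.
apply: (@le_trans _ _ (\int[P]_w `|f.[X s w] * g.[X t w]|)).
  rewrite /Rintegral fine_le//.
  - by apply: integrable_fin_num => //; exact: integrable_norm.
  - by apply: integrable_fin_num => //; exact: integrable_norm.
  apply: ge0_subset_integral => //.
  exact: (measurable_int _ (integrable_norm fg)).
have -> : (mixed setT f s f s / c + c * mixed setT g t g t) / 2 =
  \int[P]_w (c^-1 / 2 * (f.[X s w] * f.[X s w]) + c / 2 * (g.[X t w] * g.[X t w])).
  by rewrite RintegralD// !RintegralZl// /mixed_moment; ring.
apply: le_Rintegral => //; first exact: integrable_norm.
  exact: (integrableD measurableT ff' gg').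
move=> w _; set a := f.[_]; set b := g.[_].
(* AM-GM: [2 |a b| <= a^2 / c + c b^2]. *)
have -> : c^-1 / 2 * (a * a) + c / 2 * (b * b) =
  (a ^+ 2 + (c * b) ^+ 2) / (2 * c) by field; rewrite gt_eqF.
rewrite ler_pdivlMr ?mulr_gt0//.
have := sqr_ge0 (`|a| - c * `|b|).
rewrite normrM sqrrB !exprMn !real_normK ?num_real//.
by lra.
Qed.

Lemma martingale_at0 : martingale_at 0.
Proof.
move=> s t A s0 st FA; apply: eq_Rintegral => w _.
by rewrite /mpol /= !hornerC.
Qed.

Lemma second_moment t : 0 < t -> mixed setT 'X t 'X t = t.
Proof.
move=> t0; have [_ /(_ t t t0 t0) H _ _] := Xqh.
rewrite /mixed_moment; under eq_Rintegral do rewrite hornerX.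
by rewrite /Rintegral; move: H; rewrite unlock minxx => ->.
Qed.

Lemma mixed1 s : mixed setT 1 s 1 s = 1.
Proof.
rewrite /mixed_moment; under eq_Rintegral do rewrite horner1 mulr1.
rewrite Rintegral_cst// mul1r -[RHS]/(fine 1%E).
by congr fine; exact: probability_setT.
Qed.

Lemma martingale_at1 : martingale_at 1.
Proof.
move=> s t A s0 st FA; have mA := past_measurable FA; have t0 := lt_trans s0 st.
pose D r := mixed A 1 s (p 1 r) r - mixed A 1 s (p 1 s) s.
have DE u : t < u -> D t * (u - s) = (t - s) * D u.
  move=> tu; have su := lt_trans st tu.
  have := @harness_step s A s0 FA 0 t u st tu.
  rewrite /upper !mulr0n !mul0r !addr0 => /(_ _) H.
  have /H {H} : forall j, (j <= 0)%N -> martingale_at j.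
    by move=> j; rewrite leqn0 => /eqP ->; exact: martingale_at0.
  rewrite -!/(D _) sub0r mulN1r => H.
  have r0 : 1 - rho != 0 by rewrite subr_eq0 gt_eqF.
  apply: (mulfI r0); rewrite mulrA H; field.
  by rewrite subr_eq0 gt_eqF.
(* At time [r ^+ 2] the weight [r^-1] makes both halves of the bound equal to [r / 2]. *)
have Dle r : 0 < r -> t < r ^+ 2 -> `|D (r ^+ 2)| <= r + `|mixed A 1 s 'X s|.
  move=> r0 tr; have rr : 0 < r ^+ 2 by exact: exprn_gt0.
  apply: le_trans (ler_normB _ _) _; rewrite mpol1 lerD2r.
  apply: le_trans (@mixed_bound A 1 s 'X (r ^+ 2) r^-1 mA s0 rr _) _.
    by rewrite invr_gt0.
  rewrite mixed1 second_moment// le_eqVlt; apply/orP; left; apply/eqP.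
  by field; rewrite gt_eqF.
apply/eqP; rewrite -subr_eq0 -/(D t) -normr_eq0.
apply: contraT => dN0; set m := `|D t| in dN0.
have m0 : 0 < m by rewrite lt_def dN0 normr_ge0.
set C := `|mixed A 1 s 'X s| in Dle; have C0 : 0 <= C by exact: normr_ge0.
pose K := (t - s) * (1 + C).
have K0 : 0 <= K by apply: mulr_ge0; [rewrite subr_ge0 ltW|exact: addr_ge0].
(* Chosen so that [m r = m (1 + s + t) + K], which with [r >= 1] contradicts
   [m (r^2 - s) <= K r]. *)
pose r := 1 + s + t + K / m.
have r1 : 1 <= r.
  by rewrite /r -!addrA lerDl !addr_ge0 ?divr_ge0// ltW.
have r0 : 0 < r by exact: lt_le_trans r1.
have tr : t < r ^+ 2.
  apply: (@lt_le_trans _ _ r).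
    have : 0 <= K / m by rewrite divr_ge0// ltW.
    by rewrite /r; move: s0; lra.
  by rewrite expr2 ler_peMl// ltW.
have := DE _ tr; move/(congr1 Num.norm); rewrite !normrM -/m.
have sr : 0 < r ^+ 2 - s by rewrite subr_gt0 (lt_trans st).
have ts0 : 0 < t - s by rewrite subr_gt0.
rewrite (gtr0_norm sr) (gtr0_norm ts0) => E.
have B := Dle r r0 tr.
have B1 : m * (r ^+ 2 - s) <= K * r.
  rewrite E /K -mulrA (ler_wpM2l (ltW ts0))//.
  by apply: le_trans B _; rewrite mulrDl mul1r lerD2l ler_peMr.
have mr : m * r = m * (1 + s + t) + K.
  by rewrite /r; field; rewrite gt_eqF.
have : m * r * r <= K * r + m * s by move: B1; rewrite expr2; lra.
rewrite mr mulrDl.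
have : m * (1 + s + t) * 1 <= m * (1 + s + t) * r.
  by rewrite ler_wpM2l// mulr_ge0 ?addr_ge0// ltW.
have : 0 < m * (1 + t) by rewrite mulr_gt0// addr_gt0.
by lra.
Qed.

Lemma martingale n : martingale_at n.
Proof.
elim/ltn_ind: n => -[_|[_|n IH]]; [exact: martingale_at0|exact: martingale_at1|].
move=> s u A s0 su FA.
apply: (@martingale_step s A s0 FA n ((s + u) / 2)); try by lra.
by move=> j jn; apply: IH.
Qed.

(** * Vanishing means and orthogonality *)

Lemma mean_mpol n t : 0 < t -> mixed setT 1 t (p n.+1 t) t = 0.
Proof.
elim/ltn_ind: n t => n IH.
have setF r : past X r setT.
  exact: (@measurableT _ (g_sigma_algebraType
    (\bigcup_(t in [set t | 0 < t <= r]) g_sigma_algebra_preimage (X t)))).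
have mixed1s f r r' : mixed setT 1 r f r' = mixed setT 1 r' f r'.
  by apply: eq_Rintegral => w _; rewrite !horner1.
have const r r' : 0 < r -> r < r' ->
    mixed setT 1 r (p n.+1 r) r = mixed setT 1 r' (p n.+1 r') r'.
  by move=> r0 rr'; rewrite -(mixed1s _ r r') martingale.
case: n IH const => [|n] IH const t t0.
  rewrite mpol1 /mixed_moment.
  under eq_Rintegral do rewrite horner1 hornerX mul1r.
  have [/(_ t t0) H _ _ _] := Xqh.
  by rewrite /Rintegral; move: H; rewrite unlock => ->.
pose kappa r := mixed setT 1 r (p n.+2 r) r.
have IHn r : 0 < r -> mixed setT 1 r (p n.+1 r) r = 0 by exact: IH.
have E r : 0 < r -> U n.+1 r * kappa r
    + lower rho eta theta sigma tau n.+1 r * mixed setT 1 r (p n r) r =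
    mixed setT 'X r (p n.+1 r) r.
  move=> r0; rewrite (mixed_same _ _ r r 'X) mixed_rec// jacE /= IHn//.
  by rewrite mulr0 addr0.
(* Degree 2 is separate, since [p 0] has the nonzero mean [1 - rho]: its term in the recurrence
   equals [t], the second moment of [X_t], and the two cancel. *)
have [n0|n0] := posnP n.
  move: E; rewrite n0 => /(_ t t0).
  rewrite mpol1 second_moment// mpol0 /lower /om /= => H.
  have : U 1 t * kappa t = 0.
    move: H; rewrite /mixed_moment.
    under [X in _ + _ * X]eq_Rintegral do rewrite horner1 hornerC mul1r.
    rewrite Rintegral_cst// (_ : fine _ = 1); last first.
      by rewrite -[RHS]/(fine 1%E); congr fine; exact: probability_setT.
    move=> H; apply: (addIr t); rewrite add0r -[RHS]H; congr (_ + _).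
    field. by rewrite subr_eq0 gt_eqF.
  by move/eqP; rewrite mulf_eq0 gt_eqF ?U0// => /eqP; rewrite /kappa n0.
(* [kappa] is constant in time and [p n.+1] is a martingale, so both are held at time [t] while [r]
   is free to tend to 0. *)
have {}E r : 0 < r -> r < t -> U n.+1 r * kappa t = mixed setT 'X r (p n.+1 t) t.
  move=> r0 rt; rewrite (martingale_mul 'X (martingale _) r0 rt (setF r)) -E//.
  by rewrite -(prednK n0) IH ?prednK// mulr0 addr0 /kappa (const r t).
set c := mixed setT (p n.+1 t) t (p n.+1 t) t.
have c0 : 0 <= c.
  by apply: Rintegral_ge0 => w _; rewrite -expr2 sqr_ge0.
have B h : 0 < h -> h ^+ 2 < t -> `|kappa t| <= h * (1 + c) / 2.
  move=> h0 ht; have h20 : 0 < h ^+ 2 by exact: exprn_gt0.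
  apply: (@le_trans _ _ `|U n.+1 (h ^+ 2) * kappa t|).
    rewrite normrM ler_peMl// gtr0_norm ?U0// /upper -natr1 addrK -addrA lerDl.
    by rewrite addr_ge0// !mulr_ge0// ltW.
  rewrite E//.
  apply: le_trans (mixed_bound 'X (p n.+1 t) (@measurableT _ T) h20 t0 h0) _.
  rewrite second_moment// -/c le_eqVlt; apply/orP; left; apply/eqP.
  by field; rewrite gt_eqF.
rewrite -/(kappa t); apply/eqP; rewrite -normr_eq0; apply: contraT => kN0.
have k0 : 0 < `|kappa t| by rewrite lt_def kN0 normr_ge0.
set m := `|kappa t| in B kN0 k0.
(* The first bound gives [h (1 + c) <= m], hence [m <= m / 2] by [B]; the other two ensure
   [h^2 <= h < t]. *)
pose h := Num.min (m / (1 + c)) (Num.min 1 (t / 2)).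
have c1 : 0 < 1 + c by rewrite ltr_pwDl.
have h0 : 0 < h by rewrite !lt_min ltr01 !divr_gt0.
have h1 : h <= 1 by rewrite !ge_min lexx !orbT.
have ht : h <= t / 2 by rewrite !ge_min lexx !orbT.
have hm : h * (1 + c) <= m by rewrite -ler_pdivlMr// ge_min lexx.
have := B h h0; move=> /(_ _); have -> : h ^+ 2 < t.
  by apply: (@le_lt_trans _ _ h); [rewrite expr2 ler_piMl// ltW|move: ht t0; lra].
by move=> /(_ isT); move: hm k0; lra.
Qed.

(** For monomials, one factor [x] at a time is absorbed into [p n]; the recurrence lowers the index
    by at most one, so it stays above the remaining exponent until [mean_mpol] applies. *)
Lemma mpol_orthogonal_lower n (f : {poly R}) t : 0 < t -> (size f <= n)%N ->
  mixed setT f t (p n t) t = 0.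
Proof.
move=> t0 fn.
have X0 j : forall n, (j < n)%N -> mixed setT 'X^j t (p n t) t = 0.
  elim: j => [|j IH] [|m]// jm; first by rewrite expr0 mean_mpol.
  rewrite exprSr (mixed_same _ _ t t ('X^j * 'X)) -mulrA.
  rewrite -(mixed_same _ _ t t 'X^j) mixed_rec//.
  by rewrite jacE /= !IH ?(leqW (ltnW jm)) ?(ltnW jm)// !mulr0 !addr0.
rewrite mixedC -[f]coefK poly_def.
have : forall m, (m <= n)%N -> mixed setT (p n t) t (\sum_(i < m) f`_i *: 'X^i) t = 0.
  elim=> [_|m IH mn].
    rewrite big_ord0 -(scale0r 1) (mixedZr Hmom)// mul0r //.
  rewrite big_ord_recr /= (mixedDr Hmom)// IH ?(ltnW mn)// add0r.
  by rewrite (mixedZr Hmom)// mixedC X0// mulr0.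
exact.
Qed.

Lemma mpol_orthogonal m n t : 0 < t -> m != n ->
  mixed setT (p m t) t (p n t) t = 0.
Proof.
move=> t0; rewrite neq_ltn => /orP[mn|nm].
  by apply: mpol_orthogonal_lower => //; rewrite size_mpol.
by rewrite mixedC; apply: mpol_orthogonal_lower => //; rewrite size_mpol.
Qed.

End martingale.

(** * Return to conditional expectations and to the stated normalization *)

Lemma condE_past_poly d (T : measurableType d) (R : realType)
    (P : probability T R) (X : R -> {RV P >-> R}) (f g : {poly R}) (s t : R) :
  (forall r : R, 0 < r -> has_all_moments (X r)) -> 0 < s -> 0 < t ->
  (forall A, past X s A -> mixed_moment X A 1 s f t = mixed_moment X A 1 s g s) ->
  is_condE P (past X s) (fun w => f.[X t w]) (fun w => g.[X s w]).
Proof.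
move=> Hmom s0 t0 fg; split; [exact: integrable_poly|exact: integrable_poly| |].
  move=> _ [B mB <-].
  apply: (@measurable_poly_sigma_of _ _ _ _ X [set r | 0 < r <= s] g s) => //=.
  by rewrite s0 lexx.
move=> A FA; have mA : measurable A by exact: past_measurable FA.
have iA h r : 0 < r -> P.-integrable A (EFin \o (fun w => h.[X r w])).
  by move=> r0; apply: integrableS (integrable_poly Hmom h r0).
rewrite -[LHS]fineK; last by apply: integrable_fin_num => //; exact: iA.
rewrite -[RHS]fineK; last by apply: integrable_fin_num => //; exact: iA.
have := fg A FA; rewrite /mixed_moment /Rintegral.
under eq_integral do rewrite horner1 mul1r.
under [X in _ = fine X -> _]eq_integral do rewrite horner1 mul1r.
by move=> ->.
Qed.

Theorem proposition4p4 (d : measure_display) (T : measurableType d)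
    (R : realType) (P : probability T R) (X : R -> {RV P >-> R})
    (q eta theta sigma tau rho : R)
    (Xsep : separable_process X)
    (Xsq : square_integrable_process X)
    (sigma_ge0 : 0 <= sigma) (tau_ge0 : 0 <= tau)
    (Xqh : quadratic_harness X q eta theta sigma tau)
    (Hpos : 0 < (1 - sigma * tau) ^+ 2
                + (eta + theta * sigma) * (theta + eta * tau))
    (Hst : 0 <= sigma * tau < 1)
    (Hq : q = 1 - 2 * Num.sqrt (sigma * tau))
    (Hrho : rho = Num.sqrt (sigma * tau))
    (Hmom : forall t : R, 0 < t -> has_all_moments (X t))
    (Hsupp : forall t : R, 0 < t -> infinite_set (law_support (X t))) :
  exists p : nat -> R -> {poly R},
    orthogonal_martingale_polynomials X p /\
    (forall t : R, 0 < t ->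
      [/\ p 0%N t = 1,
          'X * p 0%N t = p 1%N t,
          'X * p 1%N t =
            (1 + sigma * t) *: p 2%N t
            + (((eta + theta * sigma) * t + (eta * tau + theta))
               / (1 - sigma * tau)) *: p 1%N t
            + t *: p 0%N t &
          forall n : nat, (2 <= n)%N ->
            'X * p n t =
              (1 + (n%:R - 1) * rho + n%:R * sigma * t) *: p n.+1 t
              + (gamma_coef rho eta theta sigma n * t
                 + delta_coef rho eta theta tau n) *: p n t
              + (omega_coef rho eta theta sigma tau n
                 * ((1 + (n%:R - 2) * rho) * t + tau * (n%:R - 1)))
                *: p n.-1 t]).
Proof.
have /andP[st0 st1] := Hst.
have rho_ge0 : 0 <= rho by rewrite Hrho sqrtr_ge0.
have rho2 : sigma * tau = rho ^+ 2 by rewrite Hrho sqr_sqrtr.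
have rho_lt1 : rho < 1 by rewrite Hrho -[ltRHS]sqrtr1 ltr_sqrt.
rewrite {}Hq -Hrho in Xqh.
have rn0 : 1 - rho != 0 by rewrite subr_eq0 gt_eqF.
have rn1 : 1 + rho != 0 by rewrite gt_eqF// ltr_wpDr.
pose M := mpol rho eta theta sigma tau.
(* Undoes the rescaling of degree 0, so that the constant polynomial is 1 again. *)
pose c n : R := if n == 0%N then (1 - rho)^-1 else 1.
have c0 n : c n != 0 by rewrite /c; case: ifP; rewrite ?invr_eq0 ?oner_neq0.
exists (fun n t => c n *: M n t); split; [split|].
- by move=> n t t0; rewrite size_scale// size_mpol.
- move=> n s t s0 st; have t0 := lt_trans s0 st.
  apply: condE_past_poly => // A FA.
  have mA := past_measurable FA.
  by rewrite !(mixedZr Hmom)// (martingale Hmom Xqh).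
- move=> n m t t0 nm.
  have : mixed_moment X setT (c n *: M n t) t (c m *: M m t) t = 0.
    rewrite (mixedZr Hmom)// mixedC (mixedZr Hmom)// mixedC.
    by rewrite (mpol_orthogonal Hmom Xqh)// !mulr0.
  rewrite /mixed_moment /Rintegral unlock => H.
  rewrite -[LHS]fineK ?H//; apply: integrable_fin_num => //.
  exact: integrable_polyM.
move=> t t0; split.
- by rewrite /c /M mpol0 -mul_polyC -polyCM mulVf.
- by rewrite /c /M mpol0 mpol1 -mul_polyC -polyCM mulVf// mulr1 scale1r.
(* Since [om 1] is [(1 - rho)^-2], [lower] at index 1 is [t / (1 - rho)], that is [t] times
   [c 0]. *)
- rewrite /c /M /= !scale1r mpol_rec// /upper /diag /lower gamma_coef1// delta_coef1//.
  rewrite scalerA; congr (_ *: _ + _ *: _ + _ *: _).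
  + by ring.
  + rewrite rho2; have -> : 1 - rho ^+ 2 = (1 - rho) * (1 + rho) by ring.
    by field; rewrite rn0 rn1.
  + by rewrite /om /=; field.
move=> [|[|n]]// _; rewrite /c /M /= !scale1r mpol_rec//.
Qed.
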